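(* Let $(C,F,c,f)$ be an instance of the Squared Metric Facility Location Problem and let $\gamma \ge 1$. Algorithm $CS(\gamma)$ produces a random integral solution $(x,y)$ (with $y_i=1$ iff facility $i$ is opened) such that, for every facility $i$ and city $j$, \[ E[y_i f_i] = \gamma \cdot F^*_i, \qquad E\left[\min_{i\in F,\, y_i=1} c_{ij} \right] \leq \max\left\{1 + 8e^{-\gamma}, \frac{5 e^{-\gamma}+e^{-1}}{1 - \frac{1}{\gamma}}\right\} \cdot C^*_j, \] where $(x^*,y^* )$ is the optimal LP solution computed by the algorithm, $F^*_i = y^*_i f_i$ and $C^*_j = \sum_{i \in F} x^*_{ij} c_{ij}$.
   Context: Facility Location Problem: finite disjoint sets $C$ (cities), $F$ (facilities), non-negative $c_{ij}$, $f_i$; minimize $\sum_{i\in F'}f_i+\sum_{j}\min_{i\in F'}c_{ij}$ over $F'\subseteq F$. Squared metric: $\sqrt{c_{ij}}\le \sqrt{c_{ij'}}+\sqrt{c_{i'j'}}+\sqrt{c_{i'j}}$ for all $i,i'\in F$, $j,j'\in C$. Algorithm $CS(\gamma)$: (1) Compute an optimal solution $(x^*,y^* )$ of the LP $\min \sum_i y_i f_i+\sum_{j}\sum_i x_{ij}c_{ij}$ s.t. $\sum_i x_{ij}=1$ for all $j$, $x_{ij}\le y_i$, $x,y\ge 0$. (2) Set $\bar y_i=\gamma y^*_i$, and for each city $j$ define $\bar x_{ij}$ by letting $j$ be served (fractionally, with $\bar x_{ij}\le\bar y_i$, $\sum_i\bar x_{ij}=1$) entirely by its closest facilities among those with $x^*_{ij}>0$;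 by splitting facilities one may assume $\bar x_{ij}>0\Rightarrow \bar x_{ij}=\bar y_i$ and $\bar y_i\le1$. (3) $C_j=\{i:\bar x_{ij}>0\}$, $D_j=\{i:\bar x_{ij}=0, x^*_{ij}>0\}$; for $F'$ with $\sum_{i\in F'}\bar y_i>0$, $d(j,F')=\sum_{i\in F'}c_{ij}\bar y_i/\sum_{i\in F'}\bar y_i$; $d^{(c)}_j=d(j,C_j)$, $d^{(\max)}_j=\max_{i\in C_j}c_{ij}$. Clustering: repeatedly choose a remaining city $j$ minimizing $d^{(c)}_j+d^{(\max)}_j$ as cluster center with cluster $C_j$, remove $j$ and all remaining $j'$ with $C_j\cap C_{j'}\ne\emptyset$. (4) Rounding: for each cluster center $j$ open exactly one facility of $C_j$, choosing $i$ with probability $\bar x_{ij}$; open every unclustered facility independently with probability $\bar y_i$. Connect each city to its closest open facility. *)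

(* Defs.v *)
From HB Require Import structures.
From mathcomp Require Import all_boot all_order all_algebra.
From mathcomp Require Import reals.
From mathcomp.analysis Require Import sequences exp.
Set Implicit Arguments. Unset Strict Implicit. Unset Printing Implicit Defensive.
Import Order.TTheory GRing.Theory Num.Theory.
Local Open Scope ring_scope.

Section FacilityLocation.
Variables (R : realType) (Ci Fa : finType).
Implicit Types (c : Fa -> Ci -> R) (f : Fa -> R) (x : Fa -> Ci -> R) (y : Fa -> R).

Definition squared_metric c : Prop :=
  forall (i i' : Fa) (j j' : Ci),
    Num.sqrt (c i j) <= Num.sqrt (c i j') + Num.sqrt (c i' j') + Num.sqrt (c i' j).

Definition lp_feasible x y : Prop :=
  [/\ forall j, \sum_i x i j = 1,
      forall i j, x i j <= y i,
      forall i j, 0 <= x i j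
    & forall i, 0 <= y i].

Definition lp_obj f c x y : R :=
  \sum_i y i * f i + \sum_j \sum_i x i j * c i j.

Definition lp_optimal f c x y : Prop :=
  lp_feasible x y /\
  forall x' y', lp_feasible x' y' -> lp_obj f c x y <= lp_obj f c x' y'.

(* Step (2): ybar = gamma * ystar; xbar serves each city j entirely by its
   closest facilities among those with xstar_ij > 0 (ties arbitrary). *)
Definition closest_filling c (xs : Fa -> Ci -> R) (ys : Fa -> R) (gamma : R)
    (xbar : Fa -> Ci -> R) : Prop :=
  [/\ forall j, \sum_i xbar i j = 1,
      forall i j, 0 <= xbar i j <= gamma * ys i,
      forall i j, 0 < xbar i j -> 0 < xs i j
    & forall i i' j, 0 < xbar i j -> 0 < xs i' j -> c i' j < c i j ->
        xbar i' j = gamma * ys i'].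

(* The normalization obtained by splitting facilities. *)
Definition split_normalized (ys : Fa -> R) (gamma : R) (xbar : Fa -> Ci -> R) : Prop :=
  (forall i j, 0 < xbar i j -> xbar i j = gamma * ys i) /\
  (forall i, gamma * ys i <= 1).

Definition Cset (xbar : Fa -> Ci -> R) (j : Ci) : {set Fa} := [set i | 0 < xbar i j].

Definition d_avg c (yb : Fa -> R) (A : {set Fa}) (j : Ci) : R :=
  (\sum_(i in A) c i j * yb i) / (\sum_(i in A) yb i).

Definition d_c c (ys : Fa -> R) (gamma : R) (xbar : Fa -> Ci -> R) (j : Ci) : R :=
  d_avg c (fun i => gamma * ys i) (Cset xbar j) j.

Definition d_max c (xbar : Fa -> Ci -> R) (j : Ci) : R :=
  \big[Num.max/0]_(i in Cset xbar j) c i j.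

Definition cs_key c ys gamma xbar (j : Ci) : R :=
  d_c c ys gamma xbar j + d_max c xbar j.

(* s is a possible run of the greedy clustering (list of cluster centers, in
   order of choice) starting from the set rem of remaining cities. *)
Fixpoint greedy_clustering (key : Ci -> R) (Cs : Ci -> {set Fa})
    (rem : {set Ci}) (s : seq Ci) : Prop :=
  match s with
  | [::] => rem = set0
  | j :: s' =>
      [/\ j \in rem,
          forall j', j' \in rem -> key j <= key j'
        & greedy_clustering key Cs
            (rem :\: [set j' in rem | Cs j :&: Cs j' != set0]) s']
  end.

Definition unclustered (Cs : Ci -> {set Fa}) (s : seq Ci) : {set Fa} :=
  ~: \bigcup_(j <- s) Cs j.

Definition cs_round_prob (ys : Fa -> R) (gamma : R) (xbar : Fa -> Ci -> R)
    (s : seq Ci) (S : {set Fa}) : R :=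
  (\prod_(j <- s) \sum_(i in Cset xbar j)
        ((S :&: Cset xbar j == [set i])%:R * xbar i j)) *
  \prod_(i in unclustered (Cset xbar) s)
        (if i \in S then gamma * ys i else 1 - gamma * ys i).

Definition expect (P : {set Fa} -> R) (g : {set Fa} -> R) : R :=
  \sum_(S : {set Fa}) P S * g S.

(* Connection cost of city j: distance to the closest open facility
   (0 if nothing is open; that event has probability 0). *)
Definition conn_cost c (S : {set Fa}) (j : Ci) : R :=
  if [pick i in S] is Some i0 then \big[Num.min/c i0 j]_(i in S) c i j else 0.

End FacilityLocation.

(* Main.v *)
Require Import Defs.
From HB Require Import structures.
From mathcomp Require Import all_boot all_order all_algebra.
From mathcomp Require Import reals ring lra.
From mathcomp.analysis Require Import sequences exp.
Import Order.TTheory GRing.Theory Num.Theory.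
Local Open Scope ring_scope.

(** Fix a city [j] and a cluster center [k] whose cluster meets the close facilities of [j],
    with [key k <= key j]. Let [d] be the average cost of [j] to its close facilities
    (total mass [1]), [D] the average over its remaining fractional facilities (mass
    [gamma - 1]) and [M] the maximal close cost, so [d <= M <= D] and
    [d + (gamma - 1) D <= gamma C*_j].

    The city is served by the closest open facility in its support and, if none is open, by
    the open facility of the cluster of [k]. Clusters and unclustered facilities are
    independent and open at most one facility each, so the probability that no facility of
    a set is open is a product of factors [1 - v_x] over blocks. Such products are at most
    [exp (- sum v_x)] and are convex along monotone segments; summing over distance
    thresholds, the support contributes at most [(1 - 1/e) d + (1/e - Q) D], where
    [Q <= exp (- gamma)] is the failure probability.

    After a failure, the squared triangle inequality [c i j <= 3 (c i' j + c i' k + c i k)]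
    through a common facility [i'] gives an expected cost of at most [3 d + 6 D], unless
    the cluster of [k] contains a mass [b] of facilities that are close to [k] but remote
    for [j]. In that case the excess is [3 Z / (1 - b)] with [Z <= (gamma - 1 - b) (D - M)],
    which is paid for by [Q <= (1 - b) e^b exp (- gamma)] and, when [gamma > 2], by the
    slack of the bound [1 + 8 exp (- gamma)] for [d < D]. *)

Set Implicit Arguments.
Unset Strict Implicit.
Unset Printing Implicit Defensive.

(** * Inequalities for products and exponentials *)

Lemma prod_one_sub_le_expR (R : realType) (I : finType) (P : pred I) (v : I -> R) :
  (forall i, P i -> v i <= 1) ->
  \prod_(i | P i) (1 - v i) <= expR (- \sum_(i | P i) v i).
Proof.
move=> v1; rewrite -sumrN expR_sum; apply: ler_prod => i Pi.
by rewrite subr_ge0 v1 //= expR_ge1Dx.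
Qed.

(** Induction over the factors, with [0 <= q <= p] carried along for the partial products: one more
    factor leaves the nonnegative gap [r * (1 - r) * ((x i - y i) * (p - q))]. *)
Lemma prod_convex_combination_le (R : realType) (I : finType) (r : R) (x y : I -> R) :
  0 <= r <= 1 -> (forall i, 0 <= y i <= x i) ->
  \prod_i (r * x i + (1 - r) * y i) <= r * \prod_i x i + (1 - r) * \prod_i y i.
Proof.
move=> /andP[r0 r1] xy.
pose K (p q z : R) := z <= r * p + (1 - r) * q /\ 0 <= q <= p.
suff [] : K (\prod_i x i) (\prod_i y i) (\prod_i (r * x i + (1 - r) * y i)) by [].
apply: (big_rec3 K); first by split; [lra | rewrite ler01 lexx].
move=> i p q z _ [zle /andP[q0 qp]]; have /andP[y0 yx] := xy i; split; last first.
  by rewrite mulr_ge0 //= ler_pM.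
apply: (le_trans (y := (r * x i + (1 - r) * y i) * (r * p + (1 - r) * q))).
  by apply: ler_wpM2l => //; rewrite addr_ge0 // mulr_ge0 // ?subr_ge0 // (le_trans y0).
have : 0 <= r * (1 - r) * ((x i - y i) * (p - q)).
  by rewrite !mulr_ge0 // subr_ge0.
move=> h; rewrite -subr_ge0.
by rewrite (_ : _ - _ = r * (1 - r) * ((x i - y i) * (p - q))) //; ring.
Qed.

Lemma expR_ge_quadratic (R : realType) (x : R) : 0 <= x -> 1 + x + x ^+ 2 / 2 <= expR x.
Proof.
move=> x0.
have -> : 1 + x + x ^+ 2 / 2 = series (exp_coeff x) 3%N.
  rewrite /series /exp_coeff /= !big_nat_recr //= big_nil.
  by rewrite expr0 expr1 !factS fact0 /=; field.
apply: nondecreasing_cvgn_le; last exact: is_cvg_series_exp_coeff.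
apply: nondecreasing_series => n _ _ /=; exact: exp_coeff_ge0.
Qed.

(** Convexity made explicit: [h0] and [h1] are [1 + z <= expR z] at [z = m] and [z = m - 1], and
    their weights [1 - m] and [m] satisfy [(1 - m) * (1 + m) + m * m = 1]. *)
Lemma expRN_chord (R : realType) (m : R) :
  0 <= m <= 1 -> expR (- m) <= 1 - m + m * expR (-1).
Proof.
move=> /andP[m0 m1]; have e0 := expR_ge0 (- m).
have h0 : expR (- m) * (1 + m) <= 1.
  by rewrite -[leRHS](expR0 R) -(addNr m) expRD ler_wpM2l // expR_ge1Dx.
have h1 : expR (- m) * (1 + (m - 1)) <= expR (-1).
  by rewrite -[in leRHS](addKr m (-1)) expRD ler_wpM2l // expR_ge1Dx.
have m1' : 0 <= 1 - m by lra.
have := ler_wpM2l m1' h0; have := ler_wpM2l m0 h1; lra.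
Qed.

Lemma one_sub_mul_expR_le1 (R : realType) (b : R) : (1 - b) * expR b <= 1.
Proof.
have h := expR_ge1Dx (- b); have e0 := expR_gt0 b.
by rewrite -ler_pdivlMr // div1r -expRN.
Qed.

(** Follows from [1 - (a + b) <= (1 - b) * (1 - a)] and [1 - a <= expR (- a)]. *)
Lemma one_sub_mul_expR_anti (R : realType) (a b : R) :
  0 <= a -> 0 <= b -> a + b <= 1 -> (1 - (a + b)) * expR (a + b) <= (1 - b) * expR b.
Proof.
move=> a0 b0 ab; rewrite expRD mulrA; apply: ler_wpM2r; first exact: expR_ge0.
have h := expR_ge1Dx (- a); rewrite -ler_pdivlMr ?expR_gt0 // -expRN.
by apply: (le_trans (y := (1 - b) * (1 + - a))); [nra | apply: ler_wpM2l => //; lra].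
Qed.

(** Coefficient comparison for [D - d] in the last case of the cost analysis: the excess of
    rerouting against the slack of [1 + 8 * expR (- g)]. After multiplication by [g * expR g], a
    quadratic lower bound for [expR (g - 2)] makes it polynomial. *)
Lemma slack_for_large_gamma (R : realType) (g : R) : 2 <= g ->
  3 * expR 1 * (g - 2) * expR (- g)
  <= 1 - expR (-1) - g^-1 + (6 - 8 / g) * expR (- g).
Proof.
move=> g2; set E := expR 1; set e1 := expR (-1).
have EE : E * e1 = 1 by rewrite -expRD subrr expR0.
(* The constant comes from [(1 + 1/2 + 1/8)^2 = 2.640625]. *)
have E264 : 264 / 100 <= E.
  have h : 1 + (2^-1) + (2^-1) ^+ 2 / 2 <= expR 2^-1 :> R by apply: expR_ge_quadratic; lra.
  have -> : E = expR 2^-1 ^+ 2 by rewrite expr2 -expRD /E; congr expR; lra.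
  by nra.
pose t := g - 2; have t0 : 0 <= t by rewrite /t; lra.
have Eg : expR g = E ^+ 2 * expR t.
  by rewrite expr2 -!expRD; congr expR; rewrite /t; lra.
have qt := expR_ge_quadratic t0.
have gE : g = t + 2 by rewrite /t; lra.
have g0 : 0 < g by lra.
rewrite -(ler_pM2r (expR_gt0 g)) -(ler_pM2r g0).
have -> : 3 * E * (g - 2) * expR (- g) * expR g * g = 3 * E * t * g.
  transitivity (3 * E * t * g * (expR (- g) * expR g)); first by rewrite /t; ring.
  by rewrite -expRD addNr expR0 mulr1.
have -> : (1 - e1 - g^-1 + (6 - 8 / g) * expR (- g)) * expR g * g
   = expR g * ((1 - e1) * g - 1) + 6 * g - 8.
  transitivity (expR g * ((1 - e1) * g - 1) + (6 * g - 8) * (expR (- g) * expR g)).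
    by field; lra.
  by rewrite -expRD addNr expR0; ring.
rewrite Eg.
have -> : E ^+ 2 * expR t * ((1 - e1) * g - 1) = expR t * (E * ((E - 1) * g - E)).
  transitivity (expR t * (E * ((E - (E * e1)) * g - E))); first ring.
  by rewrite EE.
have pos : 0 <= E * ((E - 1) * g - E).
  have h : 0 <= (E - 1) * t by apply: mulr_ge0; lra.
  by apply: mulr_ge0; first lra; rewrite gE; lra.
apply: (le_trans (y := (1 + t + t ^+ 2 / 2) * (E * ((E - 1) * g - E)) + 6 * g - 8)); last first.
  by have := ler_wpM2r pos qt; lra.
rewrite gE.
pose x := E - 264 / 100; have x0 : 0 <= x by rewrite /x; lra.
have -> : E = 264 / 100 + x by rewrite /x; lra.
have q0 := mulr_ge0 t0 t0.
(* At [x = 0] the difference is a cubic in [t] whose minimum over [t >= 0] is positive and lies near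
   [13 / 10]. *)
have s0 : 0 <= (t - 13 / 10) ^+ 2 by exact: sqr_ge0.
have s1 := mulr_ge0 t0 s0.
have c0 : 0 <= t ^+ 3 by exact: exprn_ge0.
have k1 : 0 <= x * (3 + t) by apply: mulr_ge0; lra.
have k2 : 0 <= x * (t * t) by apply: mulr_ge0.
have k3 : 0 <= x * t ^+ 3 by apply: mulr_ge0.
have k5 : 0 <= x * x * t by rewrite !mulr_ge0.
have k6 : 0 <= x * x * (t * t) by rewrite !mulr_ge0.
have k7 : 0 <= x * x * t ^+ 3 by rewrite !mulr_ge0.
have k8 : 0 <= x * x by rewrite !mulr_ge0.
have k9 : 0 <= x * t by rewrite !mulr_ge0.
lra.
Qed.

(** * Block decomposition of sums over sets, and layers of a cost function *)

Lemma sum_sets_prod_blocks (R : realType) (I T : finType) (lab : T -> I)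
    (F : I -> {set T} -> R) :
  \sum_(S : {set T}) \prod_x F x (S :&: [set i | lab i == x])
  = \prod_x \sum_(A : {set T} | A \subset [set i | lab i == x]) F x A.
Proof.
rewrite bigA_distr_big_dep.
(* A set amounts to the family of its traces on the label classes; [merge] inverts [split] on
   families whose members lie in their classes. *)
pose split (S : {set T}) := [ffun x => S :&: [set i | lab i == x]].
pose merge (g : {ffun I -> {set T}}) := [set i | i \in g (lab i)].
have splitK : cancel split merge.
  by move=> S; apply/setP=> i; rewrite !inE ffunE !inE eqxx andbT.
rewrite (reindex_onto split merge) /=; last first.
  move=> g /familyP gP; apply/ffunP=> x; apply/setP=> i; rewrite ffunE !inE.
  have := gP x; rewrite unfold_in => /subsetP/(_ i); rewrite inE => sub.
  case: (eqVneq (lab i) x) => [<-|ne]; first by rewrite andbT.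
  by rewrite andbF; apply/esym/negP => /sub; apply/negP.
apply: eq_big => [S|S _]; last by apply: eq_bigr => x _; rewrite ffunE.
rewrite splitK eqxx andbT; apply/esym/familyP => x.
by rewrite unfold_in ffunE subsetIr.
Qed.

(** A layer is a pair of a threshold and a height, one for each gap between consecutive values.
    Thresholds never lie below the base point, so older layers vanish at a new, lower base. *)
Lemma layer_cake_path (R : realType) (t : seq R) (b : R) :
  path <=%R b t ->
  exists L : seq (R * R),
    [/\ forall p, p \in L -> b <= p.1, forall p, p \in L -> 0 <= p.2
      & forall x, x \in b :: t -> x - b = \sum_(p <- L) p.2 * (p.1 < x)%R%:R].
Proof.
elim: t b => [|y t IH] b /=.
  by move=> _; exists [::]; split=> // x; rewrite inE => /eqP->; rewrite big_nil subrr.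
move=> /andP[by_ yt]; have [L [L1 L2 L3]] := IH y yt.
have ymin x : x \in y :: t -> y <= x.
  rewrite inE => /orP[/eqP-> //|xt].
  by move: yt; rewrite le_path_sortedE => /andP[/allP/(_ x xt)].
exists ((b, y - b) :: L); split.
- by move=> p; rewrite inE => /orP[/eqP-> //|/L1]; apply: le_trans.
- by move=> p; rewrite inE => /orP[/eqP-> |/L2 //]; rewrite subr_ge0.
move=> x; rewrite big_cons inE => /orP[/eqP->|xt].
  rewrite subrr ltxx mulr0 add0r big1_seq // => p /= pL.
  by rewrite ltNge (le_trans by_ (L1 p pL)) mulr0.
have yx := ymin x xt; rewrite -(L3 x xt) /=.
have [bx|xb] := ltP b x; first by rewrite mulr1; lra.
by rewrite mulr0 add0r; congr (_ - _); apply/le_anti/andP; split=> //; lra.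
Qed.

Lemma layer_cake (R : realType) (T : finType) (a : T -> R) :
  (forall i, 0 <= a i) ->
  exists2 L : seq (R * R), forall p, p \in L -> 0 <= p.2
      & forall i, a i = \sum_(p <- L) p.2 * (p.1 < a i)%R%:R.
Proof.
move=> a0; pose t := sort <=%R (codom a).
have pt : path <=%R 0 t.
  rewrite le_path_sortedE sort_le_sorted andbT.
  by apply/allP => x; rewrite mem_sort => /codomP[i ->].
have [L [_ L2 L3]] := layer_cake_path pt; exists L => // i.
by rewrite -L3 ?subr0 // inE mem_sort codom_f orbT.
Qed.

Lemma prod_label (R : realType) (I T : finType) (lab : T -> I) (S : {set T}) (q : T -> R) :
  \prod_(i in S) q i = \prod_x \prod_(i in S :&: [set i | lab i == x]) q i.
Proof.
rewrite (partition_big lab predT) //=; apply: eq_bigr => x _.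
by apply: eq_bigl => i; rewrite !inE.
Qed.

(** * Greedy clustering *)

Section Clustering.
Variables (R : realType) (Ci Fa : finType) (key : Ci -> R) (Cs : Ci -> {set Fa}).
Hypothesis Cs_neq0 : forall j, Cs j != set0.

Lemma greedy_clustering_sub rem s j :
  greedy_clustering key Cs rem s -> j \in s -> j \in rem.
Proof.
elim: s rem => [//|k s IH] rem /= [krem _ gs]; rewrite inE => /orP[/eqP-> //|].
by move=> /(IH _ gs); rewrite !inE => /andP[].
Qed.

Lemma greedy_clustering_uniq rem s : greedy_clustering key Cs rem s -> uniq s.
Proof.
elim: s rem => [//|k s IH] rem /= [krem _ gs]; rewrite (IH _ gs) andbT.
(* A center meets its own nonempty cluster and is therefore removed with it. *)
apply/negP => /(greedy_clustering_sub gs); rewrite !inE krem setIid Cs_neq0.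
by [].
Qed.

Lemma greedy_clustering_disjoint rem s j k i :
  greedy_clustering key Cs rem s -> j \in s -> k \in s ->
  i \in Cs j -> i \in Cs k -> j = k.
Proof.
move=> + + + ij ik; elim: s rem => [//|l s IH] rem /= [lrem _ gs].
have far m : m \in s -> i \in Cs l -> i \in Cs m -> False.
  move=> ms il im; have := greedy_clustering_sub gs ms.
  rewrite !inE negb_and => /andP[/orP[/negP //|/negPn/eqP e0 _]].
  by have : i \in Cs l :&: Cs m; [rewrite inE il im | rewrite e0 inE].
rewrite !inE => /orP[/eqP jl|js] /orP[/eqP kl|ks].
- by rewrite jl kl.
- by case: (far k) => //; rewrite -jl.
- by case: (far j) => //; rewrite -kl.
- exact: IH gs js ks.
Qed.

(** A city is removed only by a center whose cluster meets its own, and in that round it was itself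
    a candidate for the minimal key. *)
Lemma greedy_clustering_center rem s j :
  greedy_clustering key Cs rem s -> j \in rem ->
  exists2 k, k \in s & (Cs k :&: Cs j != set0) && (key k <= key j).
Proof.
elim: s rem => [|k s IH] rem /=; first by move=> ->; rewrite inE.
move=> [krem kmin gs] jrem.
have [e0|ne] := boolP (Cs k :&: Cs j == set0); last first.
  by exists k; rewrite ?inE ?eqxx // ne kmin.
have [|l ls lP] := IH _ gs; first by rewrite !inE jrem e0.
by exists l => //; rewrite inE ls orbT.
Qed.

End Clustering.

(** * The randomized rounding and its expectations *)

Lemma conn_cost_attained (R : realType) (Ci Fa : finType) (c : Fa -> Ci -> R)
    (S : {set Fa}) j i : i \in S ->
  exists2 k, k \in S & conn_cost c S j = c k j /\ forall l, l \in S -> c k j <= c l j.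
Proof.
move=> iS; case: (arg_minP (c^~ j) iS) => k kS kmin; exists k => //; split=> //.
rewrite /conn_cost; case: pickP => [l lS|/(_ i)]; last by rewrite iS.
apply/le_anti/andP; split; first exact: bigmin_le_cond.
by apply: le_bigmin => //; exact: kmin.
Qed.

Section Rounding.
Variables (R : realType) (Ci Fa : finType) (ys : Fa -> R) (gamma : R).
Variables (xbar : Fa -> Ci -> R) (s : seq Ci).
Local Notation yb i := (gamma * ys i).
Local Notation Cs := (Cset xbar).
Local Notation P := (cs_round_prob ys gamma xbar s).

Hypothesis s_uniq : uniq s.
Hypothesis s_disjoint : forall j k i,
  j \in s -> k \in s -> i \in Cs j -> i \in Cs k -> j = k.
Hypothesis xbar_ge0 : forall i j, 0 <= xbar i j.
Hypothesis xbar_sum : forall j, \sum_i xbar i j = 1.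
Hypothesis xbar_yb : forall i j, 0 < xbar i j -> xbar i j = yb i.
Hypothesis yb_ge0 : forall i, 0 <= yb i.
Hypothesis yb_le1 : forall i, yb i <= 1.

Lemma Cset_sum_yb j : \sum_(i in Cs j) yb i = 1.
Proof.
rewrite -(xbar_sum j) big_mkcond /=; apply: eq_bigr => i _; rewrite inE.
case: ifPn => [/xbar_yb -> //|]; rewrite -leNgt => h.
by apply/esym/le_anti/andP; split.
Qed.

(** Indexes the independent experiments of the rounding: one per center, one per unclustered
    facility. All other labels have empty blocks and contribute a factor [1]. *)
Definition block_label (i : Fa) : Ci + Fa :=
  if [pick j | (j \in s) && (i \in Cs j)] is Some j then inl j else inr i.

Lemma block_label_inl i j : (block_label i == inl j) = (j \in s) && (i \in Cs j).
Proof.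
rewrite /block_label; case: pickP => [k /andP[ks ik]|none].
  apply/eqP/andP => [[<-] //|[js ij]]; congr inl; exact: s_disjoint ik ij.
by rewrite none; apply/eqP.
Qed.

Lemma block_label_inr i k :
  (block_label i == inr k) = (i \in [set k]) && (k \in unclustered Cs s).
Proof.
have uncE : (i \in unclustered Cs s) = ~~ [exists j, (j \in s) && (i \in Cs j)].
  rewrite /unclustered inE bigcup_seq; congr (~~ _); apply/bigcupP/existsP.
    by case=> j js ij; exists j; rewrite js.
  by case=> j /andP[js ij]; exists j.
rewrite /block_label inE; case: pickP => [j ji|none].
  case: (eqVneq i k) => [<-|]; last by rewrite ?andbF; move=> _; apply/eqP.
  by rewrite uncE (_ : [exists j, _]) //; apply/existsP; exists j.
apply/eqP/andP => [[<-]|[/eqP-> //]]; rewrite eqxx uncE; split=> //.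
by apply/existsPn => j; rewrite none.
Qed.

Lemma prod_label_blocks (F : Ci -> R) (G : Fa -> R) :
  (\prod_(j <- s) F j) * \prod_(i in unclustered Cs s) G i
  = \prod_(x : Ci + Fa) match x with
      | inl j => if j \in s then F j else 1
      | inr i => if i \in unclustered Cs s then G i else 1
    end.
Proof.
rewrite big_sumType /= -!big_mkcond /=; congr (_ * _); exact: big_uniq.
Qed.

(* The probability generating function of the rounding: clusters and unclustered
   facilities are independent, and each block opens at most one facility. *)
Lemma expect_prod (q : Fa -> R) :
  expect P (fun S => \prod_(i in S) q i)
  = \prod_x (1 - \sum_(i | block_label i == x) yb i * (1 - q i)).
Proof.
pose F0 (x : Ci + Fa) (A : {set Fa}) : R := match x with
  | inl j => if j \in s then \sum_(i in Cs j) (A == [set i])%:R * xbar i j else 1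
  | inr i => if i \in unclustered Cs s then if i \in A then yb i else 1 - yb i else 1
  end.
pose F x A := F0 x A * \prod_(i in A) q i.
have blkl j : [set i | block_label i == inl j] = if j \in s then Cs j else set0.
  by apply/setP=> i; rewrite inE block_label_inl; case: ifP; rewrite //= inE.
have blkr k : [set i | block_label i == inr k]
    = if k \in unclustered Cs s then [set k] else set0.
  apply/setP=> i; rewrite inE block_label_inr andbC.
  by case: ifP => //= _; rewrite inE.
transitivity (\sum_S \prod_x F x (S :&: [set i | block_label i == x])).
  apply: eq_bigr => S _; rewrite /F big_split /= -prod_label; congr (_ * _).
  rewrite /cs_round_prob prod_label_blocks; apply: eq_bigr => -[j|k] _ /=.
    by case: ifP => // js; rewrite blkl js.
  by case: ifP => // ku; rewrite blkr ku !inE eqxx andbT.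
rewrite sum_sets_prod_blocks; apply: eq_bigr => x _.
rewrite [X in 1 - X](_ : _ =
  \sum_(i in [set i | block_label i == x]) yb i * (1 - q i)); last first.
  by apply: eq_bigl => i; rewrite inE.
have empty : \sum_(A : {set Fa} | A \subset set0) \prod_(i in A) q i = 1.
  rewrite (big_pred1 set0) ?big_set0 // => A; exact: subset0.
case: x => [j|k]; rewrite ?blkl ?blkr /F /F0 /=.
  case: ifP => js; last first.
    by rewrite big_set0 subr0 -[RHS]empty; apply: eq_bigr => A _; rewrite mul1r.
  (* In a cluster only singletons have nonzero weight; its total mass [1] then gives the form
     [1 - \sum yb * (1 - q)]. *)
  transitivity (\sum_(i in Cs j) yb i * q i).
    rewrite (eq_bigr (fun A : {set Fa} =>
      \sum_(i in Cs j) (A == [set i])%:R * xbar i j * \prod_(i in A) q i)); last first.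
      by move=> A _; rewrite mulr_suml.
    rewrite exchange_big /=; apply: eq_bigr => i ij.
    rewrite (bigD1 [set i]) ?sub1set //= eqxx mul1r big_set1.
    rewrite big1 ?addr0; last by move=> A /andP[_ /negPf->]; rewrite !mul0r.
    by rewrite xbar_yb //; move: ij; rewrite inE.
  rewrite -[X in X - _](Cset_sum_yb j) -sumrB; apply: eq_bigr => i _; ring.
case: ifP => ku; last first.
  by rewrite big_set0 subr0 -[RHS]empty; apply: eq_bigr => A _; rewrite mul1r.
rewrite (bigD1 set0) ?sub0set //= (bigD1 [set k]) /=; last first.
  by rewrite subxx; apply/set0Pn; exists k; rewrite inE.
rewrite !inE eqxx big_set0 !big_set1 big1 ?addr0; last first.
  move=> A /andP[/andP[Ak A0] A1]; move: Ak; rewrite subset1 => /orP[/eqP e|/eqP e].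
    by rewrite e eqxx in A1.
  by rewrite e eqxx in A0.
ring.
Qed.

Lemma cs_round_prob_ge0 S : 0 <= P S.
Proof.
rewrite mulr_ge0 // prodr_ge0 // => [j _|i _].
  by apply: sumr_ge0 => i _; rewrite mulr_ge0 // ler0n.
by case: ifP; rewrite ?subr_ge0.
Qed.

Lemma cs_round_prob_cluster S j : j \in s -> P S != 0 ->
  exists2 i, i \in Cs j & S :&: Cs j = [set i].
Proof.
move=> js PS; have [/exists_inP[i ij /eqP e]|none] := boolP [exists i in Cs j, S :&: Cs j == [set i]].
  by exists i.
case/negP: PS; rewrite /cs_round_prob (big_rem j) //= big1 ?mul0r //.
move=> i ij; have /negPf -> : S :&: Cs j != [set i].
  by apply: contra none => e; apply/exists_inP; exists i.
by rewrite mul0r.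
Qed.

(** The indicator of [i] is the difference of the generating products at [q = 1] and at [q = 1]
    except [0] at [i]. *)
Lemma expect_indicator i : expect P (fun S => (i \in S)%:R) = yb i.
Proof.
have E1 : expect P (fun S => \prod_(k in S) 1) = 1.
  by rewrite expect_prod big1 // => x _; rewrite big1 ?subr0 // => k _; rewrite subrr mulr0.
have E2 : expect P (fun S => \prod_(k in S) (k != i)%:R) = 1 - yb i.
  rewrite expect_prod (bigD1 (block_label i)) //=.
  rewrite (bigD1 i) //= eqxx big1 ?addr0; last first.
    by move=> k /andP[_ ->]; rewrite subrr mulr0.
  rewrite subr0 mulr1 big1 ?mulr1 // => x xi; rewrite big1 ?subr0 // => k /eqP kx.
  case: (eqVneq k i) => [ki|]; last by rewrite subrr mulr0.
  by rewrite -kx ki eqxx in xi.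
rewrite -[RHS](subKr 1) -E2 -[X in X - _]E1 /expect -sumrB; apply: eq_bigr => S _.
rewrite -mulrBr; congr (_ * _); rewrite big1 //.
have [iS|iS] := boolP (i \in S).
  by rewrite (bigD1 i) //= eqxx mul0r subr0.
rewrite big1 ?subrr // => k kS; rewrite (_ : k != i) //.
by apply: contraNneq iS => <-.
Qed.

(** A cluster opens exactly one facility, so setting [q] to [0] on the rest of the cluster has the
    effect of the indicator of [i]. *)
Lemma expect_indicator_prod j i (q : Fa -> R) : j \in s -> i \in Cs j ->
  expect P (fun S => (i \in S)%:R * \prod_(k in S) q k)
  = yb i * q i * \prod_(x | x != inl j)
                    (1 - \sum_(k | block_label k == x) yb k * (1 - q k)).
Proof.
move=> js ij.
pose q' k := if (k \in Cs j) && (k != i) then 0 else q k.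
transitivity (expect P (fun S => \prod_(k in S) q' k)).
  apply: eq_bigr => S _; have [->|PS] := eqVneq (P S) 0; first by rewrite !mul0r.
  congr (_ * _); have [i0 i0j e] := cs_round_prob_cluster js PS.
  have memi k : k \in Cs j -> (k \in S) = (k == i0).
    by move=> kj; rewrite -[RHS](in_set1) -e inE kj andbT.
  have [iS|iS] := boolP (i \in S).
    rewrite mul1r; apply: eq_bigr => k kS; rewrite /q'.
    case: ifP => // /andP[kj]; move: iS kS; rewrite !memi // => /eqP<- /eqP->.
    by rewrite eqxx.
  rewrite mul0r (bigD1 i0) /=; last by rewrite memi.
  rewrite /q' i0j /= (_ : i0 != i) ?mul0r //.
  by apply: contraNneq iS => <-; rewrite memi.
rewrite expect_prod (bigD1 (inl j)) //=; congr (_ * _).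
  rewrite [X in _ - X](_ : _ = \sum_(k in Cs j) yb k * (1 - q' k)); last first.
    by apply: eq_bigl => k; rewrite block_label_inl js.
  rewrite -[X in X - _](Cset_sum_yb j) -sumrB (bigD1 i) //= big1 ?addr0.
    by rewrite /q' eqxx andbF; ring.
  by move=> k /andP[kj ki]; rewrite /q' kj ki /=; ring.
apply: eq_bigr => x xj; congr (_ - _); apply: eq_bigr => k /eqP kx.
rewrite /q'; case: ifP => // /andP[kj _]; case/negP: xj.
by rewrite -kx block_label_inl js kj.
Qed.

Variable c : Fa -> Ci -> R.
Hypothesis c_ge0 : forall i j, 0 <= c i j.
Local Notation lab := block_label.

Lemma block_mass_le1 (n : Fa -> R) x : (forall i, 0 <= n i <= yb i) ->
  \sum_(i | lab i == x) n i <= 1.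
Proof.
move=> nP; apply: (le_trans (y := \sum_(i | lab i == x) yb i)).
  by apply: ler_sum => i _; case/andP: (nP i).
case: x => [j|k].
  rewrite (eq_bigl _ _ (fun i => block_label_inl i j)).
  case: (j \in s) => /=; last by rewrite big_pred0 // ler01.
  by rewrite Cset_sum_yb.
rewrite (eq_bigl _ _ (fun i => block_label_inr i k)).
case: (k \in _); last by rewrite big_pred0 ?ler01 // => i; rewrite andbF.
by rewrite (big_pred1 k) // => i; rewrite andbT inE.
Qed.

(* [n] is the part of the opening mass that city [j] tries first; [k] is the center to
   whose cluster [j] is rerouted when every such attempt fails. *)
Lemma expect_conn_cost_le (n : Fa -> R) (L : seq (R * R)) j k :
  (forall i, 0 <= n i <= yb i) -> k \in s ->
  (forall p, p \in L -> 0 <= p.2) ->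
  (forall i, c i j = \sum_(p <- L) p.2 * (p.1 < c i j)%R%:R) ->
  expect P (fun S => conn_cost c S j)
  <= \sum_(p <- L) p.2 *
       (\prod_x (1 - \sum_(i | lab i == x) n i * (c i j <= p.1)%R%:R)
        - \prod_x (1 - \sum_(i | lab i == x) n i))
     + \prod_(x | x != inl k) (1 - \sum_(i | lab i == x) n i)
       * \sum_(i in Cs k) (yb i - n i) * c i j.
Proof.
move=> nP ks L0 Lc.
(* Thinning: an open facility is tried with probability [rho i], so the products of [q t] and [qn]
   over [S] are the chances that no facility within [t], or none at all, is tried. If [yb i = 0],
   then [n i = 0] as well. *)
pose rho i := n i / yb i.
pose q t i := 1 - rho i * (c i j <= t)%R%:R.
pose qn i := 1 - rho i.
have ybrho i : yb i * rho i = n i.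
  have /andP[n0 ny] := nP i; rewrite /rho mulrC.
  have [y0|y0] := eqVneq (yb i) 0; last by rewrite mulfVK.
  by rewrite y0 mulr0; lra.
have rho0 i : 0 <= rho i by have /andP[n0 _] := nP i; rewrite divr_ge0.
have qn0 i : 0 <= qn i.
  rewrite subr_ge0 /rho; have /andP[n0 ny] := nP i.
  have [y0|y0] := eqVneq (yb i) 0; first by rewrite y0 invr0 mulr0 ler01.
  by rewrite ler_pdivrMr ?mul1r // lt0r y0 yb_ge0.
have qnq t i : qn i <= q t i.
  rewrite lerD2l lerN2 -[leRHS]mulr1 ler_wpM2l //.
  by case: (c i j <= t); rewrite ?lexx ?ler01.
have EQ t : expect P (fun S => \prod_(i in S) q t i)
    = \prod_x (1 - \sum_(i | lab i == x) n i * (c i j <= t)%R%:R).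
  rewrite expect_prod; apply: eq_bigr => x _; congr (_ - _); apply: eq_bigr => i _.
  by rewrite /q subKr mulrA ybrho.
have EQn : expect P (fun S => \prod_(i in S) qn i)
    = \prod_x (1 - \sum_(i | lab i == x) n i).
  rewrite expect_prod; apply: eq_bigr => x _; congr (_ - _); apply: eq_bigr => i _.
  by rewrite /qn subKr ybrho.
have EI i : i \in Cs k -> expect P (fun S => (i \in S)%:R * \prod_(l in S) qn l)
    = (yb i - n i) * \prod_(x | x != inl k) (1 - \sum_(i | lab i == x) n i).
  move=> ik; rewrite (expect_indicator_prod _ ks ik); congr (_ * _).
    by rewrite /qn mulrBr mulr1 ybrho.
  apply: eq_bigr => x _; congr (_ - _); apply: eq_bigr => l _.
  by rewrite /qn subKr ybrho.
(* The bound holds for each outcome: the cost is split with weights [1 - Pn] and [Pn]; layers bound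
   the first share, the open facility of the cluster of [k] the second. *)
apply: (le_trans (y := expect P (fun S =>
  \sum_(p <- L) p.2 * (\prod_(i in S) q p.1 i - \prod_(i in S) qn i)
  + \sum_(i in Cs k) c i j * ((i \in S)%:R * \prod_(l in S) qn l)))); last first.
  rewrite le_eqVlt; apply/orP; left; apply/eqP.
  rewrite /expect (eq_bigr (fun S =>
     \sum_(p <- L) p.2 * (P S * \prod_(i in S) q p.1 i - P S * \prod_(i in S) qn i)
     + \sum_(i in Cs k) c i j * (P S * ((i \in S)%:R * \prod_(l in S) qn l)))); last first.
    move=> S _; rewrite mulrDr !mulr_sumr; congr (_ + _); apply: eq_bigr => ? _; ring.
  rewrite big_split /=; congr (_ + _).
    rewrite exchange_big /=; apply: eq_bigr => p _.
    by rewrite -mulr_sumr sumrB -EQ -EQn.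
  rewrite exchange_big /= mulr_sumr; apply: eq_bigr => i ik.
  by rewrite -mulr_sumr; have := EI i ik; rewrite /expect => ->; ring.
apply: ler_sum => S _; have [->|PS] := eqVneq (P S) 0; first by rewrite !mul0r.
apply: ler_wpM2l; first exact: cs_round_prob_ge0.
have [i0 i0k e] := cs_round_prob_cluster ks PS.
have i0S : i0 \in S.
  by have : i0 \in S :&: Cs k; [rewrite e inE | rewrite inE => /andP[]].
have [i1 i1S [-> minS]] := conn_cost_attained c j i0S.
set Pn := \prod_(i in S) qn i.
have Pn0 : 0 <= Pn by apply: prodr_ge0.
have Pq t : Pn <= \prod_(i in S) q t i.
  by apply: ler_prod => i _; rewrite qn0 qnq.
have first_part : c i1 j * (1 - Pn) <= \sum_(p <- L) p.2 * (\prod_(i in S) q p.1 i - Pn).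
  rewrite {1}Lc mulr_suml big_seq [leRHS]big_seq; apply: ler_sum => p pL.
  rewrite -mulrA; apply: ler_wpM2l; first exact: L0.
  have [pc|pc] := ltP p.1 (c i1 j); last by rewrite mul0r subr_ge0.
  rewrite mul1r [X in _ <= X - _]big1 // => i iS.
  by rewrite /q leNgt (lt_le_trans pc (minS i iS)) mulr0 subr0.
have second_part : c i1 j * Pn <= \sum_(i in Cs k) c i j * ((i \in S)%:R * Pn).
  rewrite (bigD1 i0) //= i0S mul1r -[leLHS]addr0; apply: lerD.
    by rewrite ler_wpM2r // minS.
  by apply: sumr_ge0 => i _; rewrite !mulr_ge0 // ler0n.
by apply: le_trans (lerD first_part second_part); rewrite -mulrDr subrK mulr1.
Qed.

End Rounding.

(** * Probability that nothing opens within a threshold *)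

Section Survival.
Variables (R : realType) (T I : finType) (lab : T -> I) (a u w : T -> R) (M : R).
Hypothesis u_ge0 : forall i, 0 <= u i.
Hypothesis w_ge0 : forall i, 0 <= w i.
Hypothesis u_sum : \sum_i u i = 1.
Hypothesis w_sum : 0 < \sum_i w i.
Hypothesis u_close : forall i, 0 < u i -> a i <= M.
Hypothesis w_far : forall i, 0 < w i -> M <= a i.
Hypothesis block_le1 : forall x, \sum_(i | lab i == x) (u i + w i) <= 1.

Let W := \sum_i w i.
Let Qn := \prod_x (1 - \sum_(i | lab i == x) (u i + w i)).
Let Q t := \prod_x (1 - \sum_(i | lab i == x) (u i + w i) * (a i <= t)%R%:R).

Lemma sum_block_label (f : T -> R) : \sum_x \sum_(i | lab i == x) f i = \sum_i f i.
Proof. by rewrite [RHS](partition_big lab predT). Qed.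

(* For [t >= M] the vector of block masses within distance [t] is a convex combination of
   the full vector and of a vector of total mass [1] lying below it, and
   [v |-> \prod_x (1 - v x)] is convex along monotone segments. *)
Lemma survival_threshold t :
  Q t - Qn <= (1 - expR (-1)) * (\sum_i u i * (t < a i)%R%:R)
              + (expR (-1) - Qn) / W * (\sum_i w i * (t < a i)%R%:R).
Proof.
pose N x := \sum_(i | lab i == x) (u i + w i).
pose Nt x := \sum_(i | lab i == x) (u i + w i) * (a i <= t)%R%:R.
have NtN x : Nt x <= N x.
  apply: ler_sum => i _; rewrite -[leRHS]mulr1 ler_wpM2l ?addr_ge0 //.
  by case: (a i <= t); rewrite ?lexx ?ler01.
have splitE (f : T -> R) :
    \sum_i f i * (t < a i)%R%:R = \sum_i f i - \sum_i f i * (a i <= t)%R%:R.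
  by rewrite -sumrB; apply: eq_bigr => i _; rewrite ltNge; case: (a i <= t) => /=; ring.
have Q_exp : Q t <= expR (- \sum_x Nt x).
  by apply: prod_one_sub_le_expR => x _; exact: le_trans (NtN x) (block_le1 x).
(* Below [M] only close mass [m] counts, and the chord of [expR (- m)] suffices. *)
have [tM|Mt] := ltP t M.
  have w0 i : w i * (a i <= t)%R%:R = 0.
    have := w_ge0 i; rewrite le_eqVlt => /orP[/eqP<-|/w_far Ma]; first by rewrite mul0r.
    by rewrite leNgt (lt_le_trans tM Ma) mulr0.
  pose m := \sum_i u i * (a i <= t)%R%:R.
  have NtE : \sum_x Nt x = m.
    rewrite sum_block_label; apply: eq_bigr => i _.
    by rewrite mulrDl w0 addr0.
  have m01 : 0 <= m <= 1.
    rewrite -u_sum; apply/andP; split.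
      by apply: sumr_ge0 => i _; rewrite mulr_ge0 // ler0n.
    apply: ler_sum => i _; rewrite -[leRHS]mulr1 ler_wpM2l //.
    by case: (a i <= t); rewrite ?lexx ?ler01.
  rewrite !splitE u_sum -/m [X in _ / W * (_ - X)]big1 // subr0 -/W.
  rewrite -mulrA mulVf ?gt_eqF // mulr1.
  by have := expRN_chord m01; rewrite -NtE; move: Q_exp; rewrite NtE; lra.
have uE i : u i * (a i <= t)%R%:R = u i.
  have := u_ge0 i; rewrite le_eqVlt => /orP[/eqP<-|/u_close Ma]; first by rewrite mul0r.
  by rewrite (le_trans Ma Mt) mulr1.
have -> : \sum_i u i * (t < a i)%R%:R = 0.
  by rewrite splitE (eq_bigr _ (fun i _ => uE i)) subrr.
rewrite mulr0 add0r.
pose r := (\sum_i w i * (t < a i)%R%:R) / W.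
have rE : \sum_i w i * (t < a i)%R%:R = r * W by rewrite /r mulfVK // gt_eqF.
have r0 : 0 <= r.
  by rewrite divr_ge0 // ?(ltW w_sum) // sumr_ge0 // => i _; rewrite mulr_ge0 // ler0n.
have r1 : r <= 1.
  rewrite ler_pdivrMr // mul1r; apply: ler_sum => i _; rewrite -[leRHS]mulr1 ler_wpM2l //.
  by case: (t < a i); rewrite ?lexx ?ler01.
have W0 : W != 0 by rewrite gt_eqF.
rewrite rE (_ : _ / W * _ = r * (expR (-1) - Qn)); last by field.
have N_sum : \sum_x N x = 1 + W by rewrite sum_block_label big_split /= u_sum.
have Nt_sum : \sum_x Nt x = 1 + (1 - r) * W.
  rewrite sum_block_label (eq_bigr (fun i => u i + w i * (a i <= t)%R%:R)).
    by rewrite big_split /= u_sum; move: (splitE w); rewrite rE -/W; lra.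
  by move=> i _; rewrite mulrDl uE.
(* For [r = 0] the vectors [Nt] and [N] have equal sums, hence coincide. *)
move: r0; rewrite le_eqVlt => /orP[/eqP r0|r0].
  have NtNE : \sum_x (N x - Nt x) = 0 by rewrite sumrB N_sum Nt_sum -r0; ring.
  rewrite -r0 mul0r subr_le0 le_eqVlt; apply/orP; left; apply/eqP; apply: eq_bigr => x _.
  have NtN0 y : true -> 0 <= N y - Nt y by rewrite subr_ge0.
  have e : N x - Nt x = 0 by apply: (psumr_eq0P (P := xpredT)) NtNE _ _.
  by rewrite -/(N x) -/(Nt x); lra.
(* Solves [Nt = r * al + (1 - r) * N]. Entries may be negative; the bounds rest on [al <= N <= 1]
   and on total mass [1]. *)
pose al x := (Nt x - (1 - r) * N x) / r.
have alE x : r * al x = Nt x - (1 - r) * N x.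
  by rewrite /al mulrC mulfVK // gt_eqF.
have alN x : al x <= N x.
  by rewrite -(ler_pM2l r0) alE; have := NtN x; lra.
have al_sum : \sum_x al x = 1.
  apply: (mulfI (lt0r_neq0 r0)); rewrite mulr_sumr (eq_bigr _ (fun x _ => alE x)).
  by rewrite sumrB -mulr_sumr N_sum Nt_sum; ring.
have al_exp : \prod_x (1 - al x) <= expR (-1).
  by rewrite -[X in expR (- X)]al_sum; apply: prod_one_sub_le_expR => x _; exact: le_trans (alN x) (block_le1 x).
have r01 : 0 <= r <= 1 by rewrite ltW.
have QE : \prod_x (r * (1 - al x) + (1 - r) * (1 - N x)) = Q t.
  by apply: eq_bigr => x _; rewrite -/(Nt x); have := alE x; lra.
have h : Q t <= r * \prod_x (1 - al x) + (1 - r) * Qn.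
  rewrite -QE; apply: prod_convex_combination_le => // x.
  by rewrite subr_ge0 block_le1 /= lerD2l lerN2.
have := ler_wpM2l (ltW r0) al_exp; lra.
Qed.

Lemma survival_layers (L : seq (R * R)) :
  (forall p, p \in L -> 0 <= p.2) ->
  (forall i, a i = \sum_(p <- L) p.2 * (p.1 < a i)%R%:R) ->
  \sum_(p <- L) p.2 * (Q p.1 - Qn)
  <= (1 - expR (-1)) * (\sum_i u i * a i)
     + (expR (-1) - Qn) / W * (\sum_i w i * a i).
Proof.
move=> L0 La.
have layered (f : T -> R) :
    \sum_i f i * a i = \sum_(p <- L) p.2 * \sum_i f i * (p.1 < a i)%R%:R.
  rewrite (eq_bigr (fun i => \sum_(p <- L) p.2 * (f i * (p.1 < a i)%R%:R))).
    by rewrite exchange_big /=; apply: eq_bigr => p _; rewrite mulr_sumr.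
  by move=> i _; rewrite {1}La mulr_sumr; apply: eq_bigr => p _; ring.
rewrite !layered !mulr_sumr -big_split /= big_seq [leRHS]big_seq.
apply: ler_sum => p pL.
have := ler_wpM2l (L0 p pL) (survival_threshold p.1); lra.
Qed.

End Survival.

(** * Rerouting through the cluster of the center *)

Lemma squared_metric_three_hop (R : realType) (Ci Fa : finType) (c : Fa -> Ci -> R) :
  (forall i j, 0 <= c i j) -> squared_metric c ->
  forall i i' j j', c i j <= 3 * (c i' j + c i' j' + c i j').
Proof.
move=> c0 sqm i i' j j'; have := sqm i i' j j'.
rewrite -{2}(sqr_sqrtr (c0 i j)) -{2}(sqr_sqrtr (c0 i j')).
rewrite -{2}(sqr_sqrtr (c0 i' j')) -{2}(sqr_sqrtr (c0 i' j)).
have := sqrtr_ge0 (c i j).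
move: (Num.sqrt (c i j)) (Num.sqrt (c i j')) (Num.sqrt (c i' j')) (Num.sqrt (c i' j)).
move=> x y z t x0 h.
(* Squaring a sum of three terms costs the factor [3]. *)
have h2 : x ^+ 2 <= (y + z + t) ^+ 2 by rewrite ler_sqr // nnegrE // (le_trans x0).
have := sqr_ge0 (y - z); have := sqr_ge0 (z - t); have := sqr_ge0 (y - t); lra.
Qed.

Section Reroute.
Variables (R : realType) (T : finType) (A : {set T}) (u w o a b : T -> R) (M m : R).
Hypothesis u_ge0 : forall i, 0 <= u i.
Hypothesis w_ge0 : forall i, 0 <= w i.
Hypothesis o_ge0 : forall i, i \in A -> 0 <= o i.
Hypothesis b_le : forall i, i \in A -> b i <= m.
Hypothesis u_close : forall i, 0 < u i -> a i <= M.
Hypothesis mass1 : \sum_(i in A) (u i + w i + o i) = 1.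
Hypothesis meets : exists2 i, i \in A & 0 < u i.
Hypothesis hop : forall i i', a i <= 3 * (a i' + b i' + b i).

(** In the application [A] is the cluster of [k], and [a], [b] are the costs to [j] and [k]; [u],
    [w], [o] are its close, far and remaining mass as seen from [j]. [Z] is positive when the far
    mass is nearer to [k] than the average [mu]. *)
Let mu := \sum_(i in A) (u i + w i + o i) * b i.
Let alpha := \sum_(i in A) u i.
Let beta := \sum_(i in A) w i.
Let omega := \sum_(i in A) o i.
Let Z := beta * mu - \sum_(i in A) w i * b i.
Let X := \sum_(i in A) o i * a i.

Lemma reroute_masses : [/\ 0 < alpha, 0 <= beta, 0 <= omega & alpha + beta + omega = 1].
Proof.
split; [|exact: sumr_ge0|exact: sumr_ge0|by rewrite -mass1 !big_split].
case: meets => i iA ui; rewrite /alpha (bigD1 i) //=.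
by apply: ltr_pwDl => //; apply: sumr_ge0.
Qed.

(** The hub is the close facility [i] nearest to [k]. If [b i] exceeds [mu + V], so do all close
    facilities, and averaging to [mu] forces the mass [o] nearer to [k], which compensates. *)
Lemma reroute_via_close :
  X <= 3 * omega * (M + mu + m + Num.max 0 Z / (1 - beta)).
Proof.
have [al0 be0 om0 tot] := reroute_masses.
have be1 : 0 < 1 - beta by lra.
case: meets => i0 i0A ui0.
have [i /andP[iA ui] imin] :
    exists2 i, (i \in A) && (0 < u i) & forall k, k \in A -> 0 < u k -> b i <= b k.
  case: (arg_minP b (P := fun i => (i \in A) && (0 < u i)) (i0 := i0)).
    by rewrite i0A ui0.
  by move=> i iP imin; exists i => // k kA uk; apply: imin; rewrite kA uk.
set V := Num.max 0 Z / (1 - beta).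
have VE : Num.max 0 Z = (1 - beta) * V by rewrite /V mulrC mulfVK // gt_eqF.
have ZV : Z <= (1 - beta) * V by rewrite -VE le_max lexx orbT.
have om_a : X <= 3 * (omega * (M + b i) + \sum_(k in A) o k * b k).
  rewrite /omega mulr_suml -big_split /= mulr_sumr; apply: ler_sum => k kA.
  rewrite -mulrDr mulrCA; apply: ler_wpM2l; first exact: o_ge0.
  by have := hop k i; have := u_close ui; lra.
apply: (le_trans om_a); rewrite -mulrA ler_pM2l //.
have [close|far] := leP (b i) (mu + V).
  have : \sum_(k in A) o k * b k <= omega * m.
    rewrite /omega mulr_suml; apply: ler_sum => k kA; apply: ler_wpM2l; first exact: o_ge0.
    exact: b_le.
  by have := ler_wpM2l om0 close; lra.
have ub : alpha * b i <= \sum_(k in A) u k * b k.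
  rewrite /alpha mulr_suml; apply: ler_sum => k kA.
  have := u_ge0 k; rewrite le_eqVlt => /orP[/eqP<-|uk]; first by rewrite !mul0r.
  by rewrite ler_pM2l // imin.
have muE : mu = \sum_(k in A) u k * b k + \sum_(k in A) w k * b k + \sum_(k in A) o k * b k.
  by rewrite /mu -!big_split /=; apply: eq_bigr => k _; ring.
have := ler_wpM2l om0 (b_le iA); have := ler_wpM2l (ltW al0) (ltW far).
have omE : omega = 1 - beta - alpha by lra.
rewrite omE in om0 *; move: ZV; rewrite /Z; move: muE ub; lra.
Qed.

(** Each facility carrying [w] serves as hub; averaging with weights [w] produces the factor
    [beta]. *)
Lemma reroute_via_far :
  beta * X <= 3 * omega * (\sum_(i in A) w i * a i + (beta * mu - Z) + beta * m).
Proof.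
rewrite /beta mulr_suml (_ : beta * mu - Z = \sum_(i in A) w i * b i); last by rewrite /Z; ring.
rewrite mulr_suml -!big_split /= mulr_sumr; apply: ler_sum => k kA.
have -> : 3 * omega * (w k * a k + w k * b k + w k * m)
    = w k * (omega * (3 * (a k + b k + m))) by ring.
apply: ler_wpM2l => //; rewrite /X /omega mulr_suml; apply: ler_sum => i iA.
apply: ler_wpM2l; first exact: o_ge0.
by have := hop i k; have := b_le iA; lra.
Qed.

End Reroute.

(** * Case analysis of the cost and the two terms of the maximum *)

Lemma cost_bound_cases (R : realType) (g d D M mu m al be om p X Z H cost : R) :
  1 < g -> 0 <= d -> d <= M -> M <= D -> mu + m <= d + M ->
  0 < al -> 0 <= be -> 0 <= om -> al + be + om = 1 ->
  0 <= p -> p <= expR (- (g - (al + be))) ->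
  X <= 3 * om * (M + mu + m + Num.max 0 Z / (1 - be)) ->
  be * X <= 3 * om * (H + (be * mu - Z) + be * m) ->
  Z <= be * mu -> H + (g - 1 - be) * M <= (g - 1) * D ->
  cost <= (1 - expR (-1)) * d + (expR (-1) - p * om) * D + p * X ->
  cost <= (1 - expR (-1) + 3 * expR (- g)) * d + (expR (-1) + 5 * expR (- g)) * D
  \/ cost <= (1 + 8 * expR (- g)) * ((d + (g - 1) * D) / g).
Proof.
move=> g1 d0 dM MD key al0 be0 om0 tot p0 p_le hX hbX Zle HD hcost.
set e1 := expR (-1) in hcost *; set eps := expR (- g).
have eps0 : 0 <= eps by exact: expR_ge0.
have be1 : 0 < 1 - be by lra.
pose F := expR be; pose G := (1 - be) * F.
have F0 : 0 <= F by exact: expR_ge0.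
have G1 : G <= 1 by exact: one_sub_mul_expR_le1.
have G0 : 0 <= G by rewrite mulr_ge0 // ltW.
have Qn0 : 0 <= p * om by rewrite mulr_ge0.
(* [p] bounds failure outside the cluster of [k] and [om] is its failure inside, so [p * om] is the
   failure probability. *)
have Qn_le : p * om <= eps * G.
  apply: (le_trans (ler_wpM2r om0 p_le)).
  rewrite opprB addrC expRD -/eps -mulrA ler_wpM2l //.
  rewrite (_ : om = 1 - (al + be)); last lra.
  by rewrite mulrC; apply: one_sub_mul_expR_anti; lra.
have Qn_eps : p * om <= eps.
  by apply: (le_trans Qn_le); rewrite -[leRHS]mulr1 ler_wpM2l.
have D0 : 0 <= D by lra.
have easy : X <= 3 * om * (D + M + d) ->
    cost <= (1 - e1 + 3 * eps) * d + (e1 + 5 * eps) * D.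
  move=> /(ler_wpM2l p0) pX.
  have : p * om * (5 * D + 3 * d) <= eps * (5 * D + 3 * d) by rewrite ler_wpM2r //; lra.
  have := ler_wpM2l Qn0 MD; move: pX hcost; lra.
have [Z0|Z0] := leP Z 0.
  left; apply: easy; apply: (le_trans hX); rewrite max_l // mul0r addr0.
  by rewrite ler_wpM2l ?mulr_ge0 //; lra.
have be_gt0 : 0 < be.
  move: be0; rewrite le_eqVlt => /orP[/eqP be0|//].
  by move: Zle; rewrite -be0 mul0r; lra.
(* Either the far facilities are good hubs, or the far cost inside the cluster is so large that [HD]
   limits [Z]. *)
have [HZ|HZ] := leP (H - Z) (be * D).
  left; apply: easy; rewrite -(ler_pM2l be_gt0); apply: (le_trans hbX).
  have -> : be * (3 * om * (D + M + d)) = 3 * om * (be * (D + M + d)) by ring.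
  rewrite ler_wpM2l ?mulr_ge0 //; have := ler_wpM2l be0 key; lra.
have ZD : Z <= (g - 1 - be) * (D - M) by lra.
move: hX; rewrite (max_r (ltW Z0)) => hX.
pose V := Z / (1 - be); have VE : (1 - be) * V = Z by rewrite /V mulrC mulfVK // gt_eqF.
have V0 : 0 <= V by rewrite divr_ge0 // ltW.
pose Y := 6 * M + 3 * d - D + 3 * V.
have hY : cost <= (1 - e1) * d + e1 * D + p * om * Y.
  have hX' : X <= 3 * om * (2 * M + d + V).
    by apply: (le_trans hX); rewrite ler_wpM2l ?mulr_ge0 // -/V; lra.
  by move: (ler_wpM2l p0 hX') hcost; rewrite /Y; lra.
have epsd := mulr_ge0 eps0 d0; have epsD := mulr_ge0 eps0 D0.
have [Y0|Y0] := leP Y 0.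
  by left; have := mulr_ge0_le0 Qn0 Y0; lra.
pose eta := D - M; pose zeta := D - d.
have eta0 : 0 <= eta by rewrite /eta; lra.
(* The factor [1 - be] in [G] cancels the denominator of [V]. *)
have psi : G * Y <= 5 * D + 3 * d - 3 * eta + 3 * ((g - 2) * F * eta).
  have GV : G * V = F * Z by rewrite -VE /G; ring.
  have FZ : F * Z <= (G + (g - 2) * F) * eta.
    by have := ler_wpM2l F0 ZD; rewrite /G /eta; lra.
  have pos : 0 <= 5 * D + 3 * d - 3 * eta by rewrite /eta; lra.
  by have := ler_wpM2r pos G1; move: GV FZ; rewrite /Y /eta; lra.
have hpsi : cost <= (1 - e1) * d + e1 * D
    + eps * (5 * D + 3 * d - 3 * eta + 3 * ((g - 2) * F * eta)).
  have := ler_wpM2r (ltW Y0) Qn_le; rewrite -mulrA; have := ler_wpM2l eps0 psi.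
  by move: hY; lra.
have [g2|g2] := leP g 2.
  left; have g2' : (g - 2) * F * eta <= 0.
    by rewrite -mulrA mulr_le0_ge0 ?mulr_ge0 //; lra.
  have : eps * (3 * eta - 3 * ((g - 2) * F * eta)) >= 0 by rewrite mulr_ge0 //; lra.
  by move: hpsi; lra.
pose E := expR 1 : R.
have FE : F <= E by rewrite ler_expR; lra.
have FEeta : (g - 2) * F * eta <= (g - 2) * E * eta.
  by rewrite ler_wpM2r // ler_wpM2l //; lra.
have := ler_wpM2l eps0 FEeta => FEeps.
(* If [(g - 2) * E <= 1], the term [- 3 * eta] absorbs the excess; otherwise [eta] is replaced by
   the larger [zeta] and the slack lemma applies. *)
have [small|big] := leP ((g - 2) * E) 1.
  left; have := ler_wpM2r eta0 small => /(ler_wpM2l eps0).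
  by move: hpsi FEeps; lra.
right; have ez : eta <= zeta by rewrite /eta /zeta; lra.
have h1 : ((g - 2) * E - 1) * eta <= ((g - 2) * E - 1) * zeta.
  by rewrite ler_wpM2l // subr_ge0 ltW.
have := ler_wpM2l eps0 h1 => h2.
have zeta0 : 0 <= zeta by rewrite (le_trans eta0).
have := ler_wpM2r zeta0 (slack_for_large_gamma (ltW g2)).
rewrite -/E -/eps -/e1 => h3.
have -> : (d + (g - 1) * D) / g = D - g^-1 * zeta by rewrite /zeta; field; lra.
have dE : d = D - zeta by rewrite /zeta; lra.
rewrite dE in hpsi; move: hpsi FEeps h2 h3; lra.
Qed.

(** In the nonnegative quantities [d] and [D - d] the coefficients to compare are [A + B] with [K]
    and [B] with [K * (1 - g^-1)]. *)
Lemma mixed_bound_le (R : realType) (g d D A B K C : R) :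
  1 < g -> 0 <= d -> d <= D -> 0 <= A -> 0 <= B -> A + B <= K -> B / (1 - g^-1) <= K ->
  (d + (g - 1) * D) / g <= C -> A * d + B * D <= K * C.
Proof.
move=> g1 d0 dD A0 B0 ABK BK hC.
have gV : 0 < 1 - g^-1 by rewrite subr_gt0 invf_lt1 //; lra.
have K0 : 0 <= K by lra.
apply: le_trans (ler_wpM2l K0 hC).
have -> : (d + (g - 1) * D) / g = d + (1 - g^-1) * (D - d) by field; lra.
have {}BK : B <= K * (1 - g^-1) by rewrite -ler_pdivrMr.
have dD0 : 0 <= D - d by lra.
have := ler_wpM2r dD0 BK; have := ler_wpM2r d0 ABK; lra.
Qed.

(** * Close and far costs of a city against its linear programming cost *)

Section CityCosts.
Variables (R : realType) (Ci Fa : finType) (c : Fa -> Ci -> R) (gamma : R).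
Variables (xs : Fa -> Ci -> R) (ys : Fa -> R) (xbar : Fa -> Ci -> R).
Hypothesis c_ge0 : forall i j, 0 <= c i j.
Hypothesis gamma_gt1 : 1 < gamma.
Hypothesis feasible : lp_feasible xs ys.
Hypothesis filling : closest_filling c xs ys gamma xbar.
Hypothesis normalized : split_normalized ys gamma xbar.

Lemma d_max_ge i j : 0 < xbar i j -> c i j <= d_max c xbar j.
Proof. by move=> ij; apply: le_bigmax_cond; rewrite inE. Qed.

Lemma d_c_sum_Cset j : d_c c ys gamma xbar j = \sum_(i in Cset xbar j) gamma * ys i * c i j.
Proof.
have [xb1 xb0 _ _] := filling; have [xby _] := normalized.
rewrite /d_c /d_avg (Cset_sum_yb _ xb1) ?divr1 //; last by move=> i k; case/andP: (xb0 i k).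
by apply: eq_bigr => i _; rewrite mulrC.
Qed.

Lemma d_c_sum_xbar j : d_c c ys gamma xbar j = \sum_i xbar i j * c i j.
Proof.
have [xb1 xb0 _ _] := filling; have [xby _] := normalized.
rewrite d_c_sum_Cset big_mkcond /=; apply: eq_bigr => i _; rewrite inE.
case: ifPn => [/xby -> //|]; rewrite -leNgt => h; have /andP[h0 _] := xb0 i j.
by rewrite (_ : xbar i j = 0) ?mul0r //; lra.
Qed.

Lemma d_c_le_d_max j : d_c c ys gamma xbar j <= d_max c xbar j.
Proof.
have [xb1 xb0 _ _] := filling.
rewrite d_c_sum_xbar -[leRHS]mul1r -(xb1 j) mulr_suml; apply: ler_sum => i _.
have /andP[] := xb0 i j; rewrite le_eqVlt => /orP[/eqP<- _|h _]; first by rewrite !mul0r.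
by rewrite ler_pM2l // d_max_ge.
Qed.

Lemma d_max_le_unused i j : xbar i j = 0 -> 0 < xs i j -> d_max c xbar j <= c i j.
Proof.
have [_ _ _ fill] := filling; have [_ xy _ _] := feasible.
move=> x0 xpos; apply: bigmax_le => // k; rewrite inE => kj.
rewrite leNgt; apply/negP => /(fill _ _ _ kj xpos); rewrite x0 => y0.
have : 0 < gamma * ys i.
  by rewrite mulr_gt0 ?(lt_le_trans xpos (xy i j)) // (lt_trans ltr01 gamma_gt1).
by rewrite -y0 ltxx.
Qed.

(* [w] is the service of [j] by the facilities it uses in the linear program but not in the
   filling, rescaled to have total mass exactly [gamma - 1]. *)
Lemma far_mass_exists j : exists w : Fa -> R,
  [/\ forall i, 0 <= w i,
      forall i, xbar i j + w i <= gamma * ys i,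
      \sum_i w i = gamma - 1,
      forall i, 0 < w i -> d_max c xbar j <= c i j
    & d_c c ys gamma xbar j + \sum_i w i * c i j <= gamma * \sum_i xs i j * c i j].
Proof.
have [xb1 xb0 _ _] := filling; have [xby _] := normalized.
have [xs1 xy x0 y0] := feasible; have g1 := gamma_gt1.
pose v i := if xbar i j == 0 then xs i j else 0.
have v0 i : 0 <= v i by rewrite /v; case: ifP.
have vxs i : xbar i j != 0 -> xbar i j = gamma * ys i.
  by move=> h; apply: xby; rewrite lt0r h; case/andP: (xb0 i j).
have gxy i : gamma * xs i j <= gamma * ys i.
  by rewrite ler_wpM2l ?xy // ltW // (lt_trans ltr01 gamma_gt1).
pose V := \sum_i v i.
(* Used facilities have [xbar = gamma * ys >= gamma * xs], so at most [1] of the scaled service is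
   used up. *)
have gV : gamma - 1 <= gamma * V.
  have : gamma * \sum_i xs i j <= \sum_i xbar i j + gamma * V.
    rewrite /V !mulr_sumr -big_split /=; apply: ler_sum => i _; rewrite /v.
    by case: (eqVneq (xbar i j) 0) => [->|/vxs ->]; rewrite ?add0r // mulr0 addr0.
  by rewrite xs1 xb1; lra.
have V0 : 0 < V by rewrite -(pmulr_rgt0 _ (lt_trans ltr01 gamma_gt1)); lra.
pose lam := (gamma - 1) / V.
have lam0 : 0 <= lam by rewrite divr_ge0 ?ltW //; lra.
have lamg : lam <= gamma by rewrite ler_pdivrMr.
have w_sum : \sum_i lam * v i = gamma - 1 by rewrite -mulr_sumr mulfVK // gt_eqF.
have w_far i : 0 < lam * v i -> d_max c xbar j <= c i j.
  rewrite /v; case: eqP => [xb|_]; last by rewrite mulr0 ltxx.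
  move=> h; apply: d_max_le_unused => //; rewrite lt0r x0 andbT.
  by apply: contraTneq h => ->; rewrite mulr0 ltxx.
exists (fun i => lam * v i); split=> // [i|i|].
- by rewrite mulr_ge0.
- rewrite /v; case: (eqVneq (xbar i j) 0) => [->|/vxs ->]; last by rewrite mulr0 addr0.
  rewrite add0r; apply: le_trans (gxy i); exact: ler_wpM2r.
set M := d_max c xbar j in w_far *.
rewrite d_c_sum_xbar mulr_sumr -big_split /= -subr_le0 -sumrB.
(* The weight is nonnegative where the cost is at most [M] and nonpositive where it is at least [M],
   so replacing costs by [M] only increases the sum; the weights add up to [0]. *)
apply: (le_trans (y := \sum_i M * (xbar i j + lam * v i - gamma * xs i j))); last first.
  by rewrite -mulr_sumr sumrB big_split /= xb1 w_sum -mulr_sumr xs1 mulr1; lra.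
apply: ler_sum => i _; rewrite mulrA -mulrDl -mulrBl mulrC.
have [xb|xb] := eqVneq (xbar i j) 0.
  rewrite /v xb eqxx add0r -mulrBl; have := x0 i j.
  rewrite le_eqVlt => /orP[/eqP<-|xpos]; first by rewrite !mulr0.
  apply: ler_wnM2r; last exact: d_max_le_unused.
  by rewrite mulr_le0_ge0 // subr_le0.
rewrite /v (negPf xb) mulr0 addr0 vxs // ler_wpM2r ?subr_ge0 //.
by apply: d_max_ge; rewrite lt0r xb; case/andP: (xb0 i j).
Qed.

End CityCosts.

(** * Assembly of the approximation guarantee *)

Unset Implicit Arguments.

Theorem theorem4 (R : realType) (Ci Fa : finType)
  (c : Fa -> Ci -> R) (f : Fa -> R) (gamma : R)
  (xs : Fa -> Ci -> R) (ys : Fa -> R) (xbar : Fa -> Ci -> R) (s : seq Ci) :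
  (forall i j, 0 <= c i j) -> (forall i, 0 <= f i) -> squared_metric c ->
  1 <= gamma ->
  lp_optimal f c xs ys ->
  closest_filling c xs ys gamma xbar ->
  split_normalized ys gamma xbar ->
  greedy_clustering (cs_key c ys gamma xbar) (Cset xbar) [set: Ci] s ->
  (forall i : Fa,
     expect (cs_round_prob ys gamma xbar s) (fun S => (i \in S)%:R * f i)
     = gamma * (ys i * f i)) /\
  (1 < gamma -> forall j : Ci,
     expect (cs_round_prob ys gamma xbar s) (fun S => conn_cost c S j)
     <= Num.max (1 + 8 * expR (- gamma))
                ((5 * expR (- gamma) + expR (-1)) / (1 - gamma^-1))
        * \sum_i xs i j * c i j).
Proof.
move=> c0 _ sqm g1 [feas _] fill norm greedy.
have [xs1 xy x0 y0] := feas.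
have [xb1 xbP _ _] := fill; have [xby yb1] := norm.
have xb0 i j : 0 <= xbar i j by case/andP: (xbP i j).
have yb0 i : 0 <= gamma * ys i by rewrite mulr_ge0 // (le_trans ler01).
have Cs1 := Cset_sum_yb xb0 xb1 xby.
have Cs0 j : Cset xbar j != set0.
  apply/eqP => e; have := Cs1 j; rewrite e big_set0 => /eqP.
  by rewrite eq_sym oner_eq0.
have su := greedy_clustering_uniq Cs0 greedy.
have sd j k i := @greedy_clustering_disjoint _ _ _ _ _ _ _ j k i greedy.
(* At [gamma = 1] the second term of the maximum is informally infinite, while division by [0]
   yields [0]; hence the condition [1 < gamma] on the cost bound. *)
split=> [i|{}g1 j].
  rewrite mulrA -(expect_indicator su sd xb0 xb1 xby i) /expect mulr_suml.
  by apply: eq_bigr => S _; rewrite mulrA.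
have [k ks /andP[meet keyk]] := greedy_clustering_center greedy (in_setT j).
have [w [w0 wle w_sum w_far Cstar]] := far_mass_exists c0 g1 feas fill norm j.
set M := d_max c xbar j in w_far; set m := d_max c xbar k.
set d := d_c c ys gamma xbar j in Cstar.
pose lab := block_label xbar s.
pose n i := xbar i j + w i.
pose o i := gamma * ys i - n i.
have nP i : 0 <= n i <= gamma * ys i by rewrite addr_ge0 //= wle.
have dM : d <= M by exact: d_c_le_d_max fill norm j.
have d0 : 0 <= d.
  by rewrite /d (d_c_sum_xbar fill norm); apply: sumr_ge0 => i _; rewrite mulr_ge0.
have close i : 0 < xbar i j -> c i j <= M by exact: d_max_ge.
have lbl_k i : (lab i == inl k) = (i \in Cset xbar k).
  by rewrite block_label_inl // ks.
pose D := (\sum_i w i * c i j) / (gamma - 1).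
have gm1 : 0 < gamma - 1 by lra.
have DE : (gamma - 1) * D = \sum_i w i * c i j by rewrite /D mulrC mulfVK // gt_eqF.
have wM (A : pred Fa) : M * \sum_(i | A i) w i <= \sum_(i | A i) w i * c i j.
  rewrite mulr_sumr; apply: ler_sum => i _; have := w0 i.
  rewrite le_eqVlt => /orP[/eqP<-|wi]; first by rewrite mulr0 mul0r.
  by rewrite mulrC ler_pM2l // w_far.
have MD : M <= D by rewrite -(ler_pM2l gm1) DE mulrC -w_sum; exact: wM.
pose N x := \sum_(i | lab i == x) n i.
pose p := \prod_(x | x != inl k) (1 - N x).
have N1 x : N x <= 1 by exact: (block_mass_le1 sd xb0 xb1 xby yb1).
have p0 : 0 <= p by apply: prodr_ge0 => x _; rewrite subr_ge0.
have massE i : xbar i j + w i + o i = gamma * ys i by rewrite /o /n; ring.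
have o0 i : i \in Cset xbar k -> 0 <= o i by rewrite subr_ge0 wle.
have mass1 : \sum_(i in Cset xbar k) (xbar i j + w i + o i) = 1.
  by rewrite (eq_bigr _ (fun i _ => massE i)).
have meets : exists2 i, i \in Cset xbar k & 0 < xbar i j.
  by case/set0Pn: meet => i; rewrite !inE => /andP[ik ij]; exists i; rewrite ?inE.
have hop i i' : c i j <= 3 * (c i' j + c i' k + c i k) by exact: squared_metric_three_hop.
have cm i : i \in Cset xbar k -> c i k <= m by rewrite inE; exact: d_max_ge.
have [al0 be0 om0 tot] := reroute_masses (xb0^~ j) w0 o0 mass1 meets.
have B1 := reroute_via_close (xb0^~ j) w0 o0 cm close mass1 meets hop.
have B2 := reroute_via_far (xbar^~ j) w0 o0 cm hop.
set al := \sum_(i in Cset xbar k) xbar i j in al0 tot.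
set be := \sum_(i in Cset xbar k) w i in be0 tot B1 B2.
set om := \sum_(i in Cset xbar k) o i in om0 tot B1 B2.
set mu := \sum_(i in Cset xbar k) _ * c i k in B1 B2.
have muE : mu = d_c c ys gamma xbar k.
  rewrite (d_c_sum_Cset fill norm); apply: eq_bigr => i _; by rewrite massE.
have Nk : N (inl k) = al + be.
  by rewrite /N (eq_bigl _ _ lbl_k) big_split.
have QnE : \prod_x (1 - N x) = p * om.
  by rewrite (bigD1 (inl k)) //= Nk mulrC; congr (_ * _); lra.
have p_le : p <= expR (- (gamma - (al + be))).
  (* The tried mass is [1 + (gamma - 1)] in total, of which [al + be] lies in the cluster of [k]. *)
  have -> : gamma - (al + be) = \sum_(x | x != inl k) N x.
    have := @sum_block_label _ _ _ lab n; rewrite (bigD1 (inl k)) //= -/(N _) Nk.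
    by rewrite [in RHS]big_split /= xb1 w_sum; rewrite -/N; lra.
  by apply: prod_one_sub_le_expR.
have [L L0 Lc] := layer_cake (a := c^~ j) (c0^~ j).
have cost1 := expect_conn_cost_le su sd xb0 xb1 xby yb0 yb1 c0 nP ks L0 Lc.
have w_pos : 0 < \sum_i w i by rewrite w_sum.
have cost2 := survival_layers (xb0^~ j) w0 (xb1 j) w_pos close w_far N1 L0 Lc.
have cost : expect (cs_round_prob ys gamma xbar s) (fun S => conn_cost c S j)
    <= (1 - expR (-1)) * d + (expR (-1) - p * om) * D
       + p * \sum_(i in Cset xbar k) o i * c i j.
  apply: (le_trans cost1); apply: lerD; last exact: lexx.
  apply: (le_trans cost2); rewrite w_sum /d (d_c_sum_xbar fill norm).
  by apply: lerD => //; rewrite -QnE mulrAC -mulrA.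
have key : mu + m <= d + M by rewrite muE.
have Zle : be * mu - \sum_(i in Cset xbar k) w i * c i k <= be * mu.
  by rewrite gerBl; apply: sumr_ge0 => i _; rewrite mulr_ge0.
(* Far mass outside the cluster costs at least [M] per unit. *)
have HD : \sum_(i in Cset xbar k) w i * c i j + (gamma - 1 - be) * M <= (gamma - 1) * D.
  rewrite DE [leRHS](bigID (mem (Cset xbar k))) /= lerD2l.
  have -> : gamma - 1 - be = \sum_(i | i \notin Cset xbar k) w i.
    by rewrite -w_sum (bigID (mem (Cset xbar k))) /= -/be; ring.
  by rewrite mulrC; exact: wM.
have g0 : 0 < gamma by lra.
have CE : (d + (gamma - 1) * D) / gamma <= \sum_i xs i j * c i j.
  by rewrite DE ler_pdivrMr // mulrC.
have e0 := expR_gt0 (- gamma); have e10 := expR_gt0 (-1 : R).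
have e11 : expR (-1) <= 1 :> R by rewrite expR_le1; lra.
set K := Num.max _ _.
have K1 : 1 + 8 * expR (- gamma) <= K by rewrite le_max lexx.
have K2 : (5 * expR (- gamma) + expR (-1)) / (1 - gamma^-1) <= K by rewrite le_max lexx orbT.
have D0 : 0 <= D by lra.
have [h|h] := cost_bound_cases g1 d0 dM MD key al0 be0 om0 tot p0 p_le B1 B2 Zle HD cost.
  apply: (le_trans h); apply: (mixed_bound_le g1) => //; first lra; first lra; first lra.
  - by move: K1; lra.
  - by rewrite addrC.
apply: (le_trans h); apply: ler_pM => //; first by lra.
by rewrite divr_ge0 // ?(ltW g0) // addr_ge0 // mulr_ge0 // ltW.
Qed.
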